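(* Let $S$ be a regular semigroup containing $X$ as a subset such that $S$ is weakly generated by $X$. Then there is a surjective semigroup homomorphism $\varphi: F_X\to S$ with $[x]\varphi=x$ for all $x\in X$. In particular every regular semigroup weakly generated by $X$ is a homomorphic image of $F_X$ under a homomorphism whose restriction to $X$ (identified with $\{[x]:x\in X\}\subseteq F_X$) is the identity.
   Context: Let $X$ be a nonempty set and $X'=\{x':x\in X\}$ a disjoint copy of $X$; let $1$ be a new symbol and $A=X\cup X'\cup\{1\}$ (the anchors), with the involution $1'=1$, $(x)'=x'$, $(x')'=x$ for $x\in X$. For a 5-tuple $g$ write $g=(g^l,g^{la},g^c,g^{ra},g^r)$ (left entry, left anchor, middle entry, right anchor, right entry); the notation iterates, e.g. for $s\in\{l,r\}$, $g^{ls}$ is the $s$-entry of $g^l$ and $g^{lsa}$ is the $s$-anchor of $g^l$. Define $\mathcal G_0=\{1\}$; $\mathcal G_{1,e}=\{g_{xx'}:x\in X\}$ where $g_{xx'}=(1,1,xx',x',1)$ (the middle entry is a formal symbol), and $\mathcal G_{1,d}=\emptyset$. For $i\ge 2$: $\mathcal G_{i,e}=\{(g,(g^{la})',g^l,(g^{ra})',g),\ (g,(g^{ra})',g^l,(g^{la})',g) : g\in\mathcal G_{i-1,e}\}$, and $\mathcal G_{i,d}$ is the set of all $g\in\mathcal G_{i-1}\times A\times\mathcal G_{i-2}\times A\times\mathcal G_{i-1}$ such that $g^l\neq g^r$, $(g^c,g^{la})=(g^{ls},(g^{lsa})')$ for some $s\in\{l,r\}$, and $(g^c,g^{ra})=(g^{rt},(g^{rta})')$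 for some $t\in\{l,r\}$; here $\mathcal G_i=\mathcal G_{i,d}\cup\mathcal G_{i,e}$ for $i\ge1$. Put $\mathcal G^5=\bigcup_{i\ge1}\mathcal G_i$, $\mathcal G=\mathcal G^5\cup A$, $\mathcal G'=\mathcal G^5\cup\{1\}$ (the symbol $1$ is used both as an anchor and as a letter of $\mathcal G'$). The height of $g\in\mathcal G_i$ is $i$; $1$ has height $0$. For $g\in\mathcal G^5$ of height $\ge2$ let $g^L=(g^{la})'g^lg^{la}$ and $g^R=(g^{ra})'g^rg^{ra}$, words of the free semigroup $\mathcal G^+$ on the alphabet $\mathcal G$. Let $\rho$ be the congruence on $\mathcal G^+$ generated by the pairs $(xx'x,x)$, $(x'xx',x')$, $(g_{xx'},xx')$ for $x\in X$; $(1g,g)$, $(g1,g)$, $(gg,g)$ for $g\in\mathcal G'$; and $(g^cg^Lg,g)$, $(gg^Rg^c,g)$, $(g^Rgg^L,g^Rg^cg^L)$ for $g\in\mathcal G^5$ of height $\ge2$. Write $[u]$ for the $\rho$-class of $u\in\mathcal G^+$. Let $F^1_X=\mathcal G^+/\rho$ (a monoid with identity $[1]$) and let $F_X$ be the subsemigroup of $F^1_X$ generated by $\{[g]: g\in\mathcal G\setminus\{1\}\}$. A regular semigroup $S$ is weakly generated by a subset $Y\subseteq S$ if no proper regular subsemigroup of $S$ contains $Y$. *)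

(* Defs.v *)
From Stdlib Require Import List.
Import ListNotations.
Set Implicit Arguments.

Section Construction.
Variable X : Type.

Inductive Anchor : Type := A1 | AX (x : X) | AX' (x : X).

Definition ainv (a : Anchor) : Anchor :=
  match a with A1 => A1 | AX x => AX' x | AX' x => AX x end.

(* Raw terms: 1, the formal middle symbol xx', and 5-tuples
   (left entry, left anchor, middle entry, right anchor, right entry). *)
Inductive Term : Type :=
| TOne
| TXX (x : X)
| Tup (l : Term) (la : Anchor) (c : Term) (ra : Anchor) (r : Term).

Definition gxx (x : X) : Term := Tup TOne A1 (TXX x) (AX' x) TOne.

Definition tl (g : Term) : Term := match g with Tup l _ _ _ _ => l | _ => TOne end.
Definition tla (g : Term) : Anchor := match g with Tup _ la _ _ _ => la | _ => A1 end.
Definition tc (g : Term) : Term := match g with Tup _ _ c _ _ => c | _ => TOne end.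
Definition tra (g : Term) : Anchor := match g with Tup _ _ _ ra _ => ra | _ => A1 end.
Definition tr (g : Term) : Term := match g with Tup _ _ _ _ r => r | _ => TOne end.

Definition ent (s : bool) (g : Term) : Term := if s then tl g else tr g.
Definition anc (s : bool) (g : Term) : Anchor := if s then tla g else tra g.

Inductive Ge : nat -> Term -> Prop :=
| Ge1 (x : X) : Ge 1 (gxx x)
| GeL (i : nat) (g : Term) : Ge (S i) g ->
    Ge (S (S i)) (Tup g (ainv (tla g)) (tl g) (ainv (tra g)) g)
| GeR (i : nat) (g : Term) : Ge (S i) g ->
    Ge (S (S i)) (Tup g (ainv (tra g)) (tl g) (ainv (tla g)) g).

Inductive Gi : nat -> Term -> Prop :=
| Gi0 : Gi 0 TOne
| GiE (i : nat) (g : Term) : Ge i g -> Gi i g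
| GiD (i : nat) (l : Term) (la : Anchor) (c : Term) (ra : Anchor) (r : Term) :
    Gi (S i) l -> Gi i c -> Gi (S i) r -> l <> r ->
    (exists s : bool, c = ent s l /\ la = ainv (anc s l)) ->
    (exists t : bool, c = ent t r /\ ra = ainv (anc t r)) ->
    Gi (S (S i)) (Tup l la c ra r).

Definition G5 (g : Term) : Prop := exists i, 1 <= i /\ Gi i g.
Definition height_ge2 (g : Term) : Prop := exists i, Gi (S (S i)) g.

Inductive letter : Type := LG (g : Term) | LA (a : Anchor).

Definition valid_letter (a : letter) : Prop :=
  match a with LG g => G5 g | LA _ => True end.

Definition word (u : list letter) : Prop := u <> [] /\ Forall valid_letter u.

(* an element of G' = G^5 ∪ {1} viewed as a letter (1 is the anchor 1) *)
Definition letterG' (t : Term) : letter :=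
  match t with TOne => LA A1 | _ => LG t end.

Definition isG'letter (a : letter) : Prop :=
  a = LA A1 \/ exists t, G5 t /\ a = LG t.

Definition gL (g : Term) : list letter :=
  [LA (ainv (tla g)); letterG' (tl g); LA (tla g)].
Definition gR (g : Term) : list letter :=
  [LA (ainv (tra g)); letterG' (tr g); LA (tra g)].

Inductive rho_gen : list letter -> list letter -> Prop :=
| rg_xx'x (x : X) : rho_gen [LA (AX x); LA (AX' x); LA (AX x)] [LA (AX x)]
| rg_x'xx' (x : X) : rho_gen [LA (AX' x); LA (AX x); LA (AX' x)] [LA (AX' x)]
| rg_gxx (x : X) : rho_gen [LG (gxx x)] [LA (AX x); LA (AX' x)]
| rg_1g (a : letter) : isG'letter a -> rho_gen [LA A1; a] [a]
| rg_g1 (a : letter) : isG'letter a -> rho_gen [a; LA A1] [a]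
| rg_gg (a : letter) : isG'letter a -> rho_gen [a; a] [a]
| rg_cLg (g : Term) : height_ge2 g ->
    rho_gen (letterG' (tc g) :: gL g ++ [LG g]) [LG g]
| rg_gRc (g : Term) : height_ge2 g ->
    rho_gen (LG g :: gR g ++ [letterG' (tc g)]) [LG g]
| rg_RgL (g : Term) : height_ge2 g ->
    rho_gen (gR g ++ LG g :: gL g) (gR g ++ letterG' (tc g) :: gL g).

Inductive rho : list letter -> list letter -> Prop :=
| rho_refl (u : list letter) : word u -> rho u u
| rho_step (p q u v : list letter) :
    Forall valid_letter p -> Forall valid_letter q -> rho_gen u v ->
    rho (p ++ u ++ q) (p ++ v ++ q)
| rho_sym (u v : list letter) : rho u v -> rho v u
| rho_trans (u v w : list letter) : rho u v -> rho v w -> rho u w.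

(* Words over the generators G \ {1} of F_X: every element of F_X is [u]
   for such a word u, and every such [u] lies in F_X. *)
Definition FX_word (u : list letter) : Prop :=
  u <> [] /\ Forall (fun a => valid_letter a /\ a <> LA A1) u.

End Construction.

Arguments A1 {X}.

Definition regular_sg (S : Type) (mul : S -> S -> S) : Prop :=
  forall a : S, exists b : S, mul (mul a b) a = a.

Definition weakly_generated (S : Type) (mul : S -> S -> S) (Y : S -> Prop) : Prop :=
  forall T : S -> Prop,
    (forall a b, T a -> T b -> T (mul a b)) ->
    (forall a, T a -> exists b, T b /\ mul (mul a b) a = a) ->
    (forall y, Y y -> T y) ->
    forall s, T s.

(* A surjective semigroup homomorphism F_X -> S, presented through its
   action f on representative words: f u is the image of the class [u]. *)
Definition FX_surj_hom (X S : Type) (mul : S -> S -> S)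
    (f : list (letter X) -> S) : Prop :=
  (forall u v, FX_word u -> FX_word v -> rho u v -> f u = f v) /\
  (forall u v, FX_word u -> FX_word v -> f (u ++ v) = mul (f u) (f v)) /\
  (forall s : S, exists u, FX_word u /\ f u = s).

(* Main.v *)
(** We interpret the letters in [S] with an identity adjoined, sending [x'] to an
inverse of [x] and each tuple [g] of height at least 2 to an element of the
sandwich set of the idempotents [g^R g^c] and [g^c g^L]; such an element exists
because [S] is regular, and the relations of [rho] then hold.

For surjectivity, take the walks that pass between a tuple and one of its entries,
reading the anchor in between. A valley [r, c, l] either collapses ([r = l]) or has
the same value as the peak [r, g, l], where [g] has entries [l, c, r]; hence a
descent followed by an ascent can be replaced by an ascent followed by a descent,
and the values of mountains (ascents from 1 followed by descents to 1) are closed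
under products. Read backwards, a mountain becomes an inverse, so these values
form a regular subsemigroup containing [X], that is, all of [S]. *)

Require Import Defs.
From Stdlib Require Import List Classical IndefiniteDescription Lia.
Import ListNotations.

(** * Shape of the tuples at each height *)

Section TermShape.
Context {X : Type}.
Implicit Types (g l r c : Term X) (la ra : Anchor X).

Lemma ainvK (a : Anchor X) : ainv (ainv a) = a.
Proof. now destruct a. Qed.

Lemma Ge_ent i g : Ge i g -> ent true g = ent false g.
Proof. now destruct 1. Qed.

Lemma Gi0_inv g : Gi 0 g -> g = TOne X.
Proof.
inversion 1; subst; [reflexivity|].
match goal with H : Ge 0 _ |- _ => inversion H end.
Qed.

Lemma Gi1_inv g : Gi 1 g -> exists x, g = gxx x.
Proof.
inversion 1; subst.
match goal with H : Ge 1 _ |- _ => inversion H; subst end.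
now exists x.
Qed.

Lemma Gi_ent_true i g : Ge (S i) g -> Gi i (ent true g).
Proof. inversion 1; subst; simpl; [apply Gi0 | now apply GiE | now apply GiE]. Qed.

(** In type e the middle entry is the left entry of [h], which by [Ge_ent] is also its right entry.
    Hence both types are tuples over a valley [l], [c], [r] and can be treated uniformly. *)
Lemma Gi_tuple i g : Gi (S (S i)) g ->
  exists l c r s t,
    g = Tup l (ainv (anc s l)) c (ainv (anc t r)) r /\
    Gi (S i) l /\ Gi i c /\ Gi (S i) r /\ c = ent s l /\ c = ent t r.
Proof.
inversion 1 as [|j h He|j l la c ra r Hl Hc Hr Hlr [s [Es Ea]] [t [Et Ea']]]; subst.
- inversion He as [|j h Hh|j h Hh]; subst; pose proof (Ge_ent _ _ Hh) as E.
  + exists h, (ent true h), h, true, false.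
    repeat split; auto using GiE, Gi_ent_true.
  + exists h, (ent true h), h, false, true.
    repeat split; auto using GiE, Gi_ent_true.
- exists l, (ent s l), r, s, t. now repeat split.
Qed.

Lemma Gi_ent i g s : Gi (S i) g -> Gi i (ent s g).
Proof.
destruct i as [|i]; intros Hg.
- destruct (Gi1_inv _ Hg) as [x ->]. destruct s; apply Gi0.
- destruct (Gi_tuple _ _ Hg) as (l & c & r & s1 & t1 & -> & Hl & Hc & Hr & _).
  now destruct s.
Qed.

(** Fails at height 1: the right anchor of [gxx x] is [AX' x], while both anchors of [TOne] are
    [A1]. *)
Lemma anc_ent i g s : Gi (S (S i)) g ->
  exists t, anc s g = ainv (anc t (ent s g)).
Proof.
intros Hg.
destruct (Gi_tuple _ _ Hg) as (l & c & r & s1 & t1 & -> & Hl & Hc & Hr & E1 & E2).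
destruct s; [now exists s1 | now exists t1].
Qed.

(* The tuple sitting over a valley [l, c, r]. If [l = r] and [s <> t] then the
   two entries of [l] agree, so [l] is of type e and so is the new tuple. *)
Lemma Gi_peak i l r s t : Gi (S i) l -> Gi (S i) r -> ent s l = ent t r ->
  (l = r /\ s = t) \/
  Gi (S (S i)) (Tup l (ainv (anc s l)) (ent s l) (ainv (anc t r)) r).
Proof.
intros Hl Hr E.
destruct (classic (l = r)) as [<-|Hlr].
- assert (HE : s <> t -> Ge (S i) l).
  { intros Hst. inversion Hl as [|j h He|j l1 la c ra r1 _ _ _ Hne]; subst; trivial.
    destruct Hne. now destruct s, t. }
  destruct s, t; [now left | | | now left]; right; specialize (HE ltac:(easy)).
  + now apply (GiE (GeL HE)).
  + rewrite E. now apply (GiE (GeR HE)).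
- right. apply GiD; trivial.
  + now apply Gi_ent.
  + now exists s.
  + now exists t.
Qed.

End TermShape.

(** * Interpretation in a monoid with a chosen inverse of each element *)

Section Interpretation.
Context {X M : Type} (op : M -> M -> M) (e : M) (inv : M -> M) (gen : X -> M).
Local Infix "*" := op.
Hypothesis opA : forall a b c, (a * b) * c = a * (b * c).
Hypothesis op1m : forall a, e * a = a.
Hypothesis opm1 : forall a, a * e = a.
Hypothesis opVm : forall a, a * (inv a * a) = a.
Hypothesis opmV : forall a, inv a * (a * inv a) = inv a.

(** Products are kept right-nested, so a known product must also be rewritable when a further factor
    [w] follows it. *)
Lemma cut2 a b z : a * b = z -> forall w, a * (b * w) = z * w.
Proof. intros <- w. now rewrite ?opA. Qed.

Lemma cut3 a b c z : a * (b * c) = z -> forall w, a * (b * (c * w)) = z * w.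
Proof. intros <- w. now rewrite ?opA. Qed.

Lemma cut4 a b c d z : a * (b * (c * d)) = z ->
  forall w, a * (b * (c * (d * w))) = z * w.
Proof. intros <- w. now rewrite ?opA. Qed.

Lemma cut5 a b c d f z : a * (b * (c * (d * f))) = z ->
  forall w, a * (b * (c * (d * (f * w)))) = z * w.
Proof. intros <- w. now rewrite ?opA. Qed.

Ltac mrewrite H :=
  let E := fresh in
  pose proof H as E; rewrite ?opA in E; rewrite ?opA;
  first [ rewrite E
        | rewrite (cut2 _ _ _ E)
        | rewrite (cut3 _ _ _ _ E)
        | rewrite (cut4 _ _ _ _ _ E)
        | rewrite (cut5 _ _ _ _ _ _ E) ];
  clear E; rewrite ?opA.

(** For idempotents [a = pc] and [b = cq] this is the usual element [b (ab)' a] of their sandwich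
    set; when [c] is idempotent, [ab = pcq]. *)
Definition sandwich (p c q : M) : M := c * (q * (inv (p * (c * q)) * (p * c))).

Section Sandwich.
Variables p c q : M.
Hypotheses (cc : c * c = c) (cqcq : c * (q * (c * q)) = c * q)
  (pcpc : p * (c * (p * c)) = p * c).

Lemma sandwich_idem : sandwich p c q * sandwich p c q = sandwich p c q.
Proof.
unfold sandwich. rewrite ?opA. mrewrite cc. now mrewrite (opmV (p * (c * q))).
Qed.

Lemma sandwich_l : c * (q * sandwich p c q) = sandwich p c q.
Proof. unfold sandwich. rewrite ?opA. now mrewrite cqcq. Qed.

Lemma sandwich_r : sandwich p c q * (p * c) = sandwich p c q.
Proof. unfold sandwich. rewrite ?opA. now mrewrite pcpc. Qed.

Lemma sandwich_mid : p * (sandwich p c q * q) = p * (c * q).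
Proof. unfold sandwich. rewrite ?opA. now mrewrite (opVm (p * (c * q))). Qed.

End Sandwich.

(** * Values of anchors and tuples *)

Definition ival (a : Anchor X) : M :=
  match a with A1 => e | AX x => gen x | AX' x => inv (gen x) end.

Lemma ivalK a : ival a * (ival (ainv a) * ival a) = ival a.
Proof. destruct a; simpl; now rewrite ?op1m. Qed.

(* Among the tuples of [G5], only [gxx x] has a middle entry of the form [TXX x]. *)
Fixpoint tval (g : Term X) : M :=
  match g with
  | TOne _ => e
  | TXX x => gen x * inv (gen x)
  | Tup _ _ (TXX x) _ _ => gen x * inv (gen x)
  | Tup l la c ra r =>
      sandwich (ival (ainv ra) * (tval r * ival ra)) (tval c)
               (ival (ainv la) * (tval l * ival la))
  end.

Definition gLval g := ival (ainv (tla g)) * (tval (Defs.tl g) * ival (tla g)).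
Definition gRval g := ival (ainv (tra g)) * (tval (Defs.tr g) * ival (tra g)).

(** The invariant of the induction on height. [tval_anc] serves to cancel pairs of anchors when a
    valley is turned into a peak. *)
Record tval_spec (g : Term X) : Prop := TvalSpec {
  tval_idem : tval g * tval g = tval g;
  (* the valley [g, ent s g, g] collapses *)
  tval_valley : forall s,
    tval g * (ival (ainv (anc s g)) * (tval (ent s g) * (ival (anc s g) * tval g)))
    = tval g;
  tval_anc : forall s,
    tval g * (ival (ainv (anc s g)) * (ival (anc s g) * tval g)) = tval g }.

Record tval_rel (g : Term X) : Prop := TvalRel {
  tval_cL : tval (tc g) * (gLval g * tval g) = tval g;
  tval_Rc : tval g * (gRval g * tval (tc g)) = tval g;
  tval_RL : gRval g * (tval g * gLval g) = gRval g * (tval (tc g) * gLval g) }.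

Lemma tval_spec_one : tval_spec (TOne X).
Proof. split; intros; try destruct s; simpl; now rewrite ?op1m. Qed.

Lemma tval_spec_gxx x : tval_spec (gxx x).
Proof.
split; intros; try destruct s; simpl; rewrite ?op1m, ?opm1, ?opA;
  repeat (first [ mrewrite (opmV (gen x)) | mrewrite (opVm (gen x)) ]);
  reflexivity.
Qed.

Lemma tval_Tup i l la c ra r : Gi i c ->
  tval (Tup l la c ra r) =
  sandwich (gRval (Tup l la c ra r)) (tval c) (gLval (Tup l la c ra r)).
Proof. intros Hc. destruct c; trivial. inversion Hc; subst. inversion H. Qed.

(* [tval_valley] is what makes the products [c g^L] and [g^R c] idempotent, as the
   sandwich construction requires. *)
Lemma valley_cq l s : tval_spec l ->
  let q := ival (anc s l) * (tval l * ival (ainv (anc s l))) in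
  tval (ent s l) * (q * (tval (ent s l) * q)) = tval (ent s l) * q.
Proof. intros Hl; simpl. rewrite ?opA. now mrewrite (tval_valley _ Hl s). Qed.

Lemma valley_pc r t : tval_spec r ->
  let p := ival (anc t r) * (tval r * ival (ainv (anc t r))) in
  p * (tval (ent t r) * (p * tval (ent t r))) = p * tval (ent t r).
Proof. intros Hr; simpl. rewrite ?opA. now mrewrite (tval_valley _ Hr t). Qed.

(** By [anc_ent] the anchor of [l] is inverse to an anchor of its entry, so this is [tval_anc] for
    that entry. *)
Lemma tval_anc_ent i l s : Gi (S (S i)) l -> tval_spec (ent s l) ->
  tval (ent s l) * (ival (anc s l) * (ival (ainv (anc s l)) * tval (ent s l)))
  = tval (ent s l).
Proof.
intros Hl Hc. destruct (anc_ent _ _ s Hl) as [t ->].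
rewrite ainvK. apply (tval_anc _ Hc).
Qed.

Lemma ivalK' a : ival (ainv a) * (ival a * ival (ainv a)) = ival (ainv a).
Proof. pose proof (ivalK (ainv a)) as E. now rewrite ainvK in E. Qed.

Lemma tval_spec_step i l c r s t :
  Gi (S i) l -> Gi i c -> Gi (S i) r -> c = ent s l -> c = ent t r ->
  tval_spec l -> tval_spec c -> tval_spec r ->
  let g := Tup l (ainv (anc s l)) c (ainv (anc t r)) r in
  tval_rel g /\ tval_spec g.
Proof.
intros Hl Hc Hr Ecl Ecr Sl Sc Sr g.
pose proof (valley_cq _ s Sl) as Hcq. pose proof (valley_pc _ t Sr) as Hpc.
cbv zeta in Hcq, Hpc. rewrite <- Ecl in Hcq. rewrite <- Ecr in Hpc.
assert (Eg : tval g = sandwich (gRval g) (tval c) (gLval g)).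
{ now apply tval_Tup with i. }
assert (EL : gLval g = ival (anc s l) * (tval l * ival (ainv (anc s l)))).
{ unfold gLval, g; simpl. now rewrite ainvK. }
assert (ER : gRval g = ival (anc t r) * (tval r * ival (ainv (anc t r)))).
{ unfold gRval, g; simpl. now rewrite ainvK. }
rewrite <- EL in Hcq. rewrite <- ER in Hpc.
pose proof (tval_idem _ Sc) as Hcc.
pose proof (sandwich_idem (gRval g) _ (gLval g) Hcc) as Hg.
pose proof (sandwich_l (gRval g) _ (gLval g) Hcq) as HL.
pose proof (sandwich_r (gRval g) _ (gLval g) Hpc) as HR.
pose proof (sandwich_mid (gRval g) (tval c) (gLval g)) as HM.
rewrite <- Eg in Hg, HL, HR, HM.
assert (Hcg : tval c * tval g = tval g).
{ rewrite <- HL at 1. mrewrite Hcc. exact HL. }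
assert (Hgc : tval g * tval c = tval g).
{ rewrite <- HR at 1. mrewrite Hcc. exact HR. }
split.
{ now split. }
split; trivial.
(* On the left, [g g^L g = g c g^L g = g g = g]; the right side is symmetric. *)
- intros [].
  + transitivity (tval g * (gLval g * tval g)).
    { unfold gLval. now rewrite ?opA. }
    rewrite <- Hgc at 1. mrewrite HL. exact Hg.
  + transitivity (tval g * (gRval g * tval g)).
    { unfold gRval. now rewrite ?opA. }
    rewrite <- Hcg at 2. mrewrite HR. exact Hg.
(* Since [g = gc = cg], a factor that cancels between two copies of [c] also cancels between two
   copies of [g]. *)
- assert (Hmid : forall b b', tval c * (b' * (b * tval c)) = tval c ->
    tval g * (b' * (b * tval g)) = tval g).
  { intros b b' Hb. rewrite <- Hgc at 1. rewrite <- Hcg at 2.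
    mrewrite Hb. rewrite Hcg. exact Hg. }
  (* If [c] is [TOne], anchors need not cancel between copies of [c]. Instead [g = g^L g] starts
     with an anchor [a], where [a a' a = a]; likewise [g = g g^R] on the right. *)
  destruct i as [|i].
  + apply Gi0_inv in Hc. rewrite Hc in HL, HR. change (tval (TOne X)) with e in HL, HR.
    rewrite op1m in HL. rewrite opm1 in HR.
    intros [];
      [change (anc true g) with (ainv (anc s l))
      |change (anc false g) with (ainv (anc t r))]; rewrite ainvK.
    * rewrite <- HL at 2. rewrite EL.
      mrewrite (ivalK (anc s l)). mrewrite (eq_sym EL).
      rewrite HL. exact Hg.
    * rewrite <- HR at 1. rewrite ER.
      mrewrite (ivalK' (anc t r)).
      mrewrite (eq_sym ER). mrewrite HR. exact Hg.
  + intros []; apply Hmid;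
      [change (anc true g) with (ainv (anc s l))
      |change (anc false g) with (ainv (anc t r))]; rewrite ainvK.
    * rewrite Ecl. apply tval_anc_ent with i; trivial. now rewrite <- Ecl.
    * rewrite Ecr. apply tval_anc_ent with i; trivial. now rewrite <- Ecr.
Qed.

Lemma tval_specP i g : Gi i g -> tval_spec g.
Proof.
revert g. induction i as [i IH] using (well_founded_induction Wf_nat.lt_wf).
intros g Hg. destruct i as [|[|i]].
- apply Gi0_inv in Hg as ->. apply tval_spec_one.
- apply Gi1_inv in Hg as [x ->]. apply tval_spec_gxx.
- destruct (Gi_tuple _ _ Hg) as (l & c & r & s & t & -> & Hl & Hc & Hr & E1 & E2).
  apply (tval_spec_step _ _ _ _ _ _ Hl Hc Hr E1 E2);
    [apply (IH (S i)) | apply (IH i) | apply (IH (S i))]; auto.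
Qed.

Lemma tval_relP i g : Gi (S (S i)) g -> tval_rel g.
Proof.
intros Hg.
destruct (Gi_tuple _ _ Hg) as (l & c & r & s & t & -> & Hl & Hc & Hr & E1 & E2).
apply (tval_spec_step _ _ _ _ _ _ Hl Hc Hr E1 E2); eapply tval_specP; eauto.
Qed.

(** * Values of words and their invariance under [rho] *)

Definition letval (a : letter X) : M :=
  match a with LG g => tval g | LA a => ival a end.

Definition wval (u : list (letter X)) : M :=
  fold_right (fun a m => letval a * m) e u.

Lemma wval_app u v : wval (u ++ v) = wval u * wval v.
Proof. induction u as [|a u IH]; simpl; [now rewrite op1m | now rewrite IH, opA]. Qed.

Lemma letval_letterG' g : letval (letterG' g) = tval g.
Proof. now destruct g. Qed.

Lemma wval_gL g : wval (gL g) = gLval g.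
Proof. unfold wval, gL; simpl; rewrite letval_letterG'. now rewrite opm1. Qed.

Lemma wval_gR g : wval (gR g) = gRval g.
Proof. unfold wval, gR; simpl; rewrite letval_letterG'. now rewrite opm1. Qed.

Lemma letval_idem a : isG'letter a -> letval a * letval a = letval a.
Proof.
intros [->|(g & (i & _ & Hg) & ->)]; simpl.
- apply op1m.
- apply (tval_idem _ (tval_specP _ _ Hg)).
Qed.

Lemma wval_rho_gen u v : rho_gen u v -> wval u = wval v.
Proof.
destruct 1 as [x|x|x|a Ha|a Ha|a Ha|g [i Hg]|g [i Hg]|g [i Hg]];
  try pose proof (tval_relP _ _ Hg) as Rg.
- simpl. now rewrite opm1.
- simpl. now rewrite opm1.
- simpl. now rewrite !opm1.
- simpl. now rewrite op1m.
- simpl. now rewrite op1m.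
- simpl. now rewrite opm1, letval_idem.
- change (letval (letterG' (tc g)) * wval (gL g ++ [LG g]) = wval [LG g]).
  rewrite wval_app, wval_gL, letval_letterG'. simpl. rewrite opm1.
  apply (tval_cL _ Rg).
- change (tval g * wval (gR g ++ [letterG' (tc g)]) = wval [LG g]).
  rewrite wval_app, wval_gR. simpl. rewrite letval_letterG', !opm1.
  apply (tval_Rc _ Rg).
- rewrite !wval_app, wval_gR.
  change (gRval g * (tval g * wval (gL g))
          = gRval g * (letval (letterG' (tc g)) * wval (gL g))).
  rewrite wval_gL, letval_letterG'. apply (tval_RL _ Rg).
Qed.

Lemma wval_rho u v : rho u v -> wval u = wval v.
Proof.
induction 1 as [|p q u v _ _ H| |]; try congruence.
rewrite !wval_app. now rewrite (wval_rho_gen _ _ H).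
Qed.

(** * Walks up and down the tuples *)

(* In [up i a j b w], [i] and [j] are the heights of the end points [a], [b] and
   [w] is the value of the word read along the walk, end points included. *)
Inductive up : nat -> Term X -> nat -> Term X -> M -> Prop :=
| up_refl i a : Gi i a -> up i a i a (tval a)
| up_step i a j h s w : up i a j (ent s h) w -> Gi (S j) h ->
    up i a (S j) h (w * (ival (anc s h) * tval h)).

Inductive down : nat -> Term X -> nat -> Term X -> M -> Prop :=
| down_refl i a : Gi i a -> down i a i a (tval a)
| down_step j h i a s w : down j (ent s h) i a w -> Gi (S j) h ->
    down (S j) h i a (tval h * (ival (ainv (anc s h)) * w)).

Lemma Gi_idem i g : Gi i g -> tval g * tval g = tval g.
Proof. intros Hg. apply (tval_idem _ (tval_specP _ _ Hg)). Qed.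

Lemma up_Gi i a j b w : up i a j b w -> Gi j b.
Proof. now destruct 1. Qed.

Lemma up_end i a j b w : up i a j b w -> w * tval b = w.
Proof.
destruct 1; rewrite ?opA.
- eapply Gi_idem; eauto.
- now erewrite Gi_idem by eauto.
Qed.

Lemma up_start i a j b w : up i a j b w -> tval a * w = w.
Proof.
induction 1 as [|i a j h s w Hw IH Hh].
- eapply Gi_idem; eauto.
- now rewrite <- opA, IH.
Qed.

Lemma down_start i a j b w : down i a j b w -> tval a * w = w.
Proof.
destruct 1.
- eapply Gi_idem; eauto.
- rewrite <- opA. now erewrite Gi_idem by eauto.
Qed.

(** The shared end point [b] is read twice, which is harmless because its value is idempotent. *)
Lemma up_trans i a j b k c v w :
  up i a j b v -> up j b k c w -> up i a k c (v * w).
Proof.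
intros Hv Hw. induction Hw as [j b Hb|j b k h s w Hw IH Hh].
- now rewrite (up_end _ _ _ _ _ Hv).
- rewrite <- opA. apply up_step; auto.
Qed.

Lemma down_trans i a j b k c v w :
  down i a j b v -> down j b k c w -> down i a k c (v * w).
Proof.
intros Hv Hw. induction Hv as [j b Hb|j h i a s v Hv IH Hh].
- now rewrite (down_start _ _ _ _ _ Hw).
- rewrite ?opA. apply down_step; auto.
Qed.

Lemma valley_flip i l r s t : Gi (S i) l -> Gi (S i) r -> ent s l = ent t r ->
  let w := tval r * (ival (ainv (anc t r)) * (tval (ent s l) * (ival (anc s l) * tval l))) in
  (l = r /\ w = tval l) \/
  exists g s' t', Gi (S (S i)) g /\ l = ent s' g /\ r = ent t' g /\
    w = tval r * (ival (anc t' g) * (tval g * (ival (ainv (anc s' g)) * tval l))).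
Proof.
intros Hl Hr E w.
destruct (Gi_peak i l r s t Hl Hr E) as [[<- <-]|Hg].
- left. split; trivial. apply (tval_valley _ (tval_specP _ _ Hl)).
- right. eexists _, true, false. split; [exact Hg|]. repeat split; cbn [anc tla tra].
  pose proof (tval_RL _ (tval_relP _ _ Hg)) as HM.
  cbn [tc] in HM. unfold gLval, gRval in HM. cbn [tla tra Defs.tl Defs.tr] in HM.
  pose proof (tval_anc _ (tval_specP _ _ Hl) s) as Al.
  pose proof (tval_anc _ (tval_specP _ _ Hr) t) as Ar.
  rewrite !ainvK in *.
  set (G := tval (Tup _ _ _ _ _)) in *. clearbody G.
  set (a := ival (anc s l)) in *. set (a' := ival (ainv (anc s l))) in *.
  set (b := ival (anc t r)) in *. set (b' := ival (ainv (anc t r))) in *.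
  (* The relation reads [b r b' G a l a' = b r b' c a l a']. Multiplied by [r b'] and [a l], it
     loses its outer factors through [r b' b r = r] and [l a' a l = l]. *)
  pose proof (f_equal (fun z => tval r * (b' * z) * (a * tval l)) HM) as HM'.
  cbv beta in HM'. rewrite ?opA in HM'.
  rewrite !Al in HM'.
  rewrite !(cut4 _ _ _ _ _ Ar) in HM'. symmetry. exact HM'.
Qed.

(** Each ascending step creates a valley to flip, which pushes the single descent to the end. If a
    valley collapses, the descent is used up and the rest of the walk only ascends. *)
Lemma down1_up j a k c w s h : up j a k c w -> Gi (S j) h -> a = ent s h ->
  let w' := tval h * (ival (ainv (anc s h)) * w) in
  up (S j) h k c w' \/
  exists p t v, up (S j) h (S k) p v /\ c = ent t p /\
    w' = v * (ival (ainv (anc t p)) * tval c).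
Proof.
intros Hw. cbv zeta. induction Hw as [j a Ha|j a k c t w Hw IH Hc]; intros Hh E.
- right. exists h, s, (tval h). split; [now apply up_refl | now split].
- destruct (IH Hh E) as [Hu|(p & t' & v & Hv & Ep & Ew)].
  + left.
    match goal with |- up _ _ _ _ ?x =>
      replace x with ((tval h * (ival (ainv (anc s h)) * w)) * (ival (anc t c) * tval c))
      by now rewrite ?opA end.
    now apply up_step.
  + assert (Ew' : tval h * (ival (ainv (anc s h)) * (w * (ival (anc t c) * tval c)))
      = v * (tval p * (ival (ainv (anc t' p)) * (tval (ent t c) * (ival (anc t c) * tval c))))).
    { rewrite <- (up_end _ _ _ _ _ Hv) in Ew. rewrite ?opA in Ew.
      rewrite (cut3 _ _ _ _ Ew). now rewrite ?opA. }
    destruct (valley_flip k c p t t' Hc (up_Gi _ _ _ _ _ Hv) Ep)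
      as [[<- Ev]|(g & s1 & t1 & Hg & -> & E1 & Ev)]; cbv zeta in Ev; rewrite Ev in Ew'.
    * left. rewrite Ew'. now rewrite (up_end _ _ _ _ _ Hv).
    * right. exists g, s1, (v * (ival (anc t1 g) * tval g)).
      split; [apply up_step; congruence|]. split; trivial.
      rewrite Ew'. rewrite <- (opA v), (up_end _ _ _ _ _ Hv). now rewrite ?opA.
Qed.

Lemma down_up i a j b k c v w : down j b i a v -> up i a k c w ->
  exists m p v' w', up j b m p v' /\ down m p k c w' /\ v * w = v' * w'.
Proof.
intros Hv. revert k c w. induction Hv as [i a Ha|j h i a s v Hv IH Hh]; intros k c w Hw.
- exists k, c, w, (tval c). split; [|split]; trivial.
  + eapply down_refl, up_Gi; eauto.
  + rewrite (up_end _ _ _ _ _ Hw). eapply up_start; eauto.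
- destruct (IH _ _ _ Hw) as (m & p & v' & w' & Hv' & Hw' & E).
  destruct (down1_up _ _ _ _ _ s h Hv' Hh eq_refl)
    as [Hu|(p' & t & u & Hu & -> & Eu)].
  + exists m, p. do 2 eexists. split; [exact Hu|]. split; [exact Hw'|].
    rewrite ?opA. now rewrite E.
  + exists (S m), p'. do 2 eexists. split; [exact Hu|]. split.
    * eapply down_step with (s := t); [exact Hw'|]. eapply up_Gi; eauto.
    * rewrite <- (opA u), (up_end _ _ _ _ _ Hu).
      rewrite ?opA, E. rewrite ?opA in Eu. rewrite (cut3 _ _ _ _ Eu), ?opA.
      now rewrite (down_start _ _ _ _ _ Hw').
Qed.

(** A walk down and back along the same path contracts from the bottom, one [tval_valley] at a
    time. *)
Lemma up_reverse i a j b w : up i a j b w ->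
  exists w', down j b i a w' /\ w' * w = tval b.
Proof.
induction 1 as [i a Ha|i a j h s w Hw (w' & Hw' & E) Hh].
- exists (tval a). split; [now apply down_refl | eapply Gi_idem; eauto].
- eexists. split; [eapply down_step with (s := s); eauto|].
  mrewrite E. apply (tval_valley _ (tval_specP _ _ Hh)).
Qed.

Lemma down_reverse j b i a w : down j b i a w ->
  exists w', up i a j b w' /\ w * w' = tval b.
Proof.
induction 1 as [i a Ha|j h i a s w Hw (w' & Hw' & E) Hh].
- exists (tval a). split; [now apply up_refl | eapply Gi_idem; eauto].
- eexists. split; [eapply up_step with (s := s); eauto|].
  mrewrite E. apply (tval_valley _ (tval_specP _ _ Hh)).
Qed.

(** * The regular semigroup of mountain values *)

Definition mountain (w : M) : Prop :=
  exists m p v v', up 0 (TOne X) m p v /\ down m p 0 (TOne X) v' /\ w = v * v'.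

Lemma mountain_op w1 w2 : mountain w1 -> mountain w2 -> mountain (w1 * w2).
Proof.
intros (m & p & v1 & v1' & U1 & D1 & ->) (n & q & v2 & v2' & U2 & D2 & ->).
destruct (down_up _ _ _ _ _ _ _ _ D1 U2) as (k & r & u & u' & U & D & E).
exists k, r, (v1 * u), (u' * v2').
split; [eapply up_trans; eauto|]. split; [eapply down_trans; eauto|].
now mrewrite E.
Qed.

(** In [v v' u u' v v'] the valleys [v' u] and [u' v] both contract to the value of the peak [p]. *)
Lemma mountain_regular w : mountain w -> exists w', mountain w' /\ (w * w') * w = w.
Proof.
intros (m & p & v & v' & U & D & ->).
destruct (up_reverse _ _ _ _ _ U) as (u' & D' & E').
destruct (down_reverse _ _ _ _ _ D) as (u & U' & E).
exists (u * u'). split; [now exists m, p, u, u'|].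
mrewrite E. mrewrite E'.
rewrite (down_start _ _ _ _ _ D), <- opA. now rewrite (up_end _ _ _ _ _ U).
Qed.

(** Up to [gxx x] on the left with anchor [A1], down on the right, where [AX' x] is read as [AX x]:
    the value is [x x' x = x]. *)
Lemma mountain_gen x : mountain (gen x).
Proof.
exists 1, (gxx x). do 2 eexists.
split; [eapply up_step with (s := true); [apply up_refl, Gi0 | apply GiE, Ge1]|].
split; [eapply down_step with (s := false); [apply down_refl, Gi0 | apply GiE, Ge1]|].
simpl. rewrite ?op1m, ?opm1, ?opA. now mrewrite (opVm (gen x)).
Qed.

Definition word_val (w : M) : Prop := exists u, Forall (@valid_letter X) u /\ wval u = w.

Lemma word_val_op w1 w2 : word_val w1 -> word_val w2 -> word_val (w1 * w2).
Proof.
intros (u & Hu & <-) (v & Hv & <-). exists (u ++ v). split.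
- now apply Forall_app.
- apply wval_app.
Qed.

Lemma word_val_ival a : word_val (ival a).
Proof. exists [LA a]. split; [now repeat constructor | apply opm1]. Qed.

Lemma word_val_tval i g : Gi i g -> word_val (tval g).
Proof.
destruct i as [|i]; intros Hg.
- apply Gi0_inv in Hg as ->. apply (word_val_ival A1).
- exists [LG g]. split; [|apply opm1].
  repeat constructor. exists (S i). split; trivial. lia.
Qed.

Lemma mountain_word_val w : mountain w -> word_val w.
Proof.
assert (Hup : forall i a j b w, up i a j b w -> word_val w).
{ induction 1; eauto using word_val_op, word_val_ival, word_val_tval. }
assert (Hdown : forall i a j b w, down i a j b w -> word_val w).
{ induction 1; eauto using word_val_op, word_val_ival, word_val_tval. }
intros (m & p & v & v' & U & D & ->). eauto using word_val_op.
Qed.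

Lemma word_val_delete_one u : Forall (@valid_letter X) u ->
  exists u', Forall (fun a => valid_letter a /\ a <> LA A1) u' /\ wval u' = wval u.
Proof.
induction 1 as [|a u Ha Hu (u' & Hu' & E)].
- exists []. now split.
- destruct (classic (a = LA A1)) as [->|Ha1].
  + exists u'. split; trivial. simpl. now rewrite op1m.
  + exists (a :: u'). split; [now constructor|]. simpl. now rewrite E.
Qed.

Section NonTrivial.
Hypothesis op_eq1 : forall a b, a * b = e -> a = e /\ b = e.
Hypothesis gen1 : forall x, gen x <> e.

(** The value of a tuple has that of its left entry as a factor; descending along left entries leads
    to some [gxx x], whose value has the factor [gen x]. *)
Lemma tval_neq1 i g : Gi (S i) g -> tval g <> e.
Proof.
revert g. induction i as [|i IH]; intros g Hg E.
- destruct (Gi1_inv _ Hg) as [x ->]. simpl in E.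
  now destruct (gen1 x), (op_eq1 _ _ E).
- destruct (Gi_tuple _ _ Hg) as (l & c & r & s & t & -> & Hl & Hc & _).
  rewrite (tval_Tup i) in E by trivial. unfold sandwich in E.
  apply op_eq1 in E as [_ E]. apply op_eq1 in E as [E _].
  unfold gLval in E. apply op_eq1 in E as [_ E]. apply op_eq1 in E as [E _].
  now apply (IH l).
Qed.

Lemma letval_neq1 a : valid_letter a -> a <> LA A1 -> letval a <> e.
Proof.
destruct a as [g|[|x|x]]; simpl.
- intros ([|i] & Hi & Hg) _; [lia|]. now apply tval_neq1 with i.
- easy.
- intros _ _. apply gen1.
- intros _ _ E. pose proof (opmV (gen x)) as H. rewrite E, op1m in H.
  rewrite opm1 in H. now apply (gen1 x).
Qed.

Lemma wval_neq1 u : FX_word u -> wval u <> e.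
Proof.
intros [Hu Hf] E. destruct Hf as [|a u [Ha Ha1] _]; [easy|].
simpl in E. apply op_eq1 in E as [E _]. now apply (letval_neq1 a).
Qed.

End NonTrivial.

End Interpretation.

(** The identity [None] is new even if [S] is already a monoid, so a product is [None] only if both
    factors are. *)
Definition omul {S : Type} (mul : S -> S -> S) (a b : option S) : option S :=
  match a, b with
  | None, _ => b
  | _, None => a
  | Some a, Some b => Some (mul a b)
  end.

Theorem mainTheorem2 (X S : Type) (mul : S -> S -> S) (iota : X -> S) :
  inhabited X ->
  (forall a b c : S, mul a (mul b c) = mul (mul a b) c) ->
  (forall x y : X, iota x = iota y -> x = y) ->
  regular_sg mul ->
  weakly_generated mul (fun s => exists x, s = iota x) ->
  exists f : list (letter X) -> S,
    FX_surj_hom mul f /\ (forall x : X, f [LA (AX x)] = iota x).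
Proof.
intros [x0] mulA _ reg wgen.
assert (opA : forall a b c, omul mul (omul mul a b) c = omul mul a (omul mul b c)).
{ intros [a|] [b|] [c|]; simpl; now rewrite ?mulA. }
assert (op1m : forall a, omul mul None a = a) by easy.
assert (opm1 : forall a, omul mul a None = a) by now intros [a|].
assert (Hinv : exists inv, forall a,
  omul mul a (omul mul (inv a) a) = a /\
  omul mul (inv a) (omul mul a (inv a)) = inv a).
{ apply (functional_choice (fun a b => omul mul a (omul mul b a) = a /\
    omul mul b (omul mul a b) = b)).
  intros [a|]; [|now exists None].
  (* From [a b a = a] alone, [b a b] is an inverse of [a] in both senses. *)
  destruct (reg a) as [b Hb]. exists (Some (mul (mul b a) b)). simpl.
  split; f_equal; rewrite ?mulA, ?Hb; trivial.
  now rewrite <- !(mulA b), !Hb. }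
destruct Hinv as [inv Hinv].
assert (opVm := fun a => proj1 (Hinv a)). assert (opmV := fun a => proj2 (Hinv a)).
cbv beta in opVm, opmV.
set (gen x := Some (iota x)).
pose (val := wval (omul mul) None inv gen).
assert (val_app : forall u v, val (u ++ v) = omul mul (val u) (val v)).
{ intros u v. now apply wval_app. }
assert (val_FX : forall u, FX_word u -> val u <> None).
{ intros u. apply wval_neq1; trivial; try easy. intros [a|] [b|]; easy. }
(* The default [iota x0] only makes [f] total: by [val_FX] it never occurs on an [FX_word]. *)
pose (f u := match val u with Some s => s | None => iota x0 end).
assert (val_f : forall u, FX_word u -> val u = Some (f u)).
{ intros u Hu. unfold f. specialize (val_FX u Hu). now destruct (val u). }
exists f. split; [split; [|split]|].
- intros u v _ _ Huv. unfold f, val.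
  now rewrite (wval_rho _ _ _ _ opA op1m opm1 opVm opmV _ _ Huv).
- intros u v Hu Hv. unfold f at 1. now rewrite val_app, (val_f u), (val_f v).
- intros s.
  assert (Ms : mountain (omul mul) None inv gen (Some s)).
  { revert s. apply wgen.
    - intros a b Ha Hb. change (Some (mul a b)) with (omul mul (Some a) (Some b)).
      now apply mountain_op.
    - intros a Ha.
      destruct (mountain_regular _ _ _ _ opA op1m opm1 opVm opmV _ Ha)
        as ([b|] & Hb & E).
      + exists b. split; trivial. simpl in E. congruence.
      (* If the inverse mountain has value [None], then [E] says that [a] is idempotent, hence its
         own inverse. *)
      + exists a. split; trivial. simpl in E. congruence.
    - intros a [x ->]. now apply (mountain_gen (omul mul) None inv gen). }
  apply mountain_word_val in Ms as (u & Hu & Eu); trivial.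
  destruct (word_val_delete_one (omul mul) None inv gen op1m u Hu)
    as (u' & Hu' & Eu').
  exists u'. split.
  + split; trivial. intros ->. simpl in Eu'. congruence.
  + unfold f, val. now rewrite Eu', Eu.
- easy.
Qed.
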